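(* Let $\gamma>-\tfrac12$ and $G\in\mathbb{N}$. Let $f\in L^2\big([-\pi,\pi],\mathbb{C};w_\theta^{(\gamma,0)}\big)\cap L^2\big([-\pi,\pi],\mathbb{C};w_\theta^{(\gamma+G,0)}\big)$ have the expansions $$f(\theta)=\sum_{k\in\mathbb{Z}}\hat f_k^{(\gamma)}\Psi_k^{(\gamma)}(\theta)\quad\text{and}\quad f(\theta)=\sum_{k\in\mathbb{Z}}\hat f_k^{(\gamma+G)}\Psi_k^{(\gamma+G)}(\theta)$$ in the respective weighted spaces. Then, for every $k\in\mathbb{Z}$, the coefficients of the second expansion are obtained exactly from those of the first by the finite sum $$\hat f_k^{(\gamma+G)}=\sum_{\substack{l\in\mathbb{Z}\\ |k|\le|l|\le|k|+G}}\lambda_{k,l}^{\Psi}\,\hat f_l^{(\gamma)},$$ where $\lambda_{k,l}^\Psi=\big\langle\Psi_l^{(\gamma)},\Psi_k^{(\gamma+G)}\big\rangle_{w_\theta^{(\gamma+G,0)}}$.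
   Context: For $\alpha,\beta>-1$ and $n\in\mathbb{N}_0$, $\tilde P_n^{(\alpha,\beta)}$ is the classical Jacobi polynomial $P_n^{(\alpha,\beta)}$ divided by its norm in $L^2([-1,1];(1-r)^\alpha(1+r)^\beta)$. For $\gamma>-\tfrac12$, $w_\theta^{(\gamma,0)}(\theta)=(1+\cos\theta)^\gamma$, $\langle f,g\rangle_w=\int_{-\pi}^\pi f\,\overline g\,w\,d\theta$, and $$\Psi_0^{(\gamma)}(\theta)=\tfrac1{\sqrt2}\tilde P_0^{(-1/2,\gamma-1/2)}(\cos\theta),$$ $$\Psi_k^{(\gamma)}(\theta)=\tfrac12\Big[\tilde P_{|k|}^{(-1/2,\gamma-1/2)}(\cos\theta)+i\,\mathrm{sgn}(k)\sin(\theta)\,\tilde P_{|k|-1}^{(1/2,\gamma+1/2)}(\cos\theta)\Big]\quad(k\in\mathbb{Z}\setminus\{0\}).$$ For each $\gamma>-\tfrac12$ the family $\{\Psi_k^{(\gamma)}\}_{k\in\mathbb{Z}}$ is a complete orthonormal system in $L^2([-\pi,\pi],\mathbb{C};w_\theta^{(\gamma,0)})$, and $\hat f_k^{(\gamma)}=\langle f,\Psi_k^{(\gamma)}\rangle_{w_\theta^{(\gamma,0)}}$. *)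

(* Defs.v *)
From HB Require Import structures.
From mathcomp Require Import all_boot all_order all_algebra.
From mathcomp Require Import complex.
From mathcomp Require Import all_classical all_reals all_analysis.

Set Implicit Arguments.
Unset Strict Implicit.
Unset Printing Implicit Defensive.

Import Order.TTheory GRing.Theory Num.Theory.
Import numFieldNormedType.Exports.

Local Open Scope classical_set_scope.
Local Open Scope ring_scope.
Local Open Scope complex_scope.

Section JacobiPolynomials.
Context {R : realType}.
Implicit Types (a b r x : R) (n m : nat).

Definition gbinom x m : R := (\prod_(j < m) (x - j%:R)) / m`!%:R.

(* The expansion of P_n^(a,b) in powers of (r - 1) / 2 and (r + 1) / 2; it has the
   classical normalization P_n^(a,b)(1) = gbinom (n + a) n. *)
Definition jacobi a b n : {poly R} :=
  \sum_(s < n.+1)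
     (gbinom (n%:R + a) (n - s) * gbinom (n%:R + b) s)
       *: ((2^-1 *: ('X - 1)) ^+ s * (2^-1 *: ('X + 1)) ^+ (n - s)).

(* At r = -1 and r = 1 a negative real power is not defined; powR then takes
   the value 0, which does not affect the integral. *)
Definition jacobi_norm a b n : R :=
  Num.sqrt (\int[lebesgue_measure]_(r in `[-1, 1])
    ((jacobi a b n).[r] ^+ 2 * ((1 - r) `^ a * (1 + r) `^ b))).

Definition jacobi_normalized a b n r : R :=
  (jacobi a b n).[r] / jacobi_norm a b n.

End JacobiPolynomials.

Section WeightedL2.
Context {R : realType}.
Implicit Types (w : R -> R) (f g : R -> R[i]).

(* Elements of the weighted space are handled through representatives; only
   their values on [-pi, pi] matter. *)
Definition sqnorm w f : \bar R :=
  \int[lebesgue_measure]_(t in `[- pi, pi])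
    (ComplexField.Normc.normc (f t) ^+ 2 * w t)%:E.

Definition in_L2 w f : Prop :=
  [/\ measurable_fun `[- pi, pi] (fun t => complex.Re (f t)),
      measurable_fun `[- pi, pi] (fun t => complex.Im (f t)) &
      (sqnorm w f < +oo)%E].

Definition inner w f g : R[i] :=
  (\int[lebesgue_measure]_(t in `[- pi, pi])
     complex.Re (f t * conjc (g t) * (w t)%:C)) +i*
  (\int[lebesgue_measure]_(t in `[- pi, pi])
     complex.Im (f t * conjc (g t) * (w t)%:C)).

(* The sum over all integers converges to f in the weighted L^2 norm, in the
   sense of the symmetric partial sums |k| <= N. *)
Definition L2_expansion w f (c : int -> R[i]) (e : int -> R -> R[i]) : Prop :=
  (fun N : nat => sqnorm w
     (fun t => f t - \sum_(k \in [set k : int | (`|k| <= N)%N]) c k * e k t))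
    @ \oo --> 0%E.

End WeightedL2.

Section SzegoFourier.
Context {R : realType}.
Implicit Types (gamma t : R) (k l : int) (f : R -> R[i]).

Definition weight gamma t : R := (1 + cos t) `^ gamma.

Definition Psi gamma k t : R[i] :=
  if k == 0 then
    (Num.sqrt 2)^-1%:C
      * (jacobi_normalized (- 2^-1) (gamma - 2^-1) 0 (cos t))%:C
  else
    2^-1%:C
      * ((jacobi_normalized (- 2^-1) (gamma - 2^-1) `|k|%N (cos t))%:C
         + (0 +i* 1) * (sgz k)%:~R * (sin t)%:C
           * (jacobi_normalized 2^-1 (gamma + 2^-1) `|k|%N.-1 (cos t))%:C).

Definition coef gamma f k : R[i] := inner (weight gamma) f (Psi gamma k).

Definition lambda gamma (G : nat) k l : R[i] :=
  inner (weight (gamma + G%:R)) (Psi gamma l) (Psi (gamma + G%:R) k).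

End SzegoFourier.

(* Main.v *)
(** The weights differ by the factor (1 + cos t)^G <= 2^G, so the partial sums of
the first expansion also converge to f in the second space, and pairing them
with Psi_k^(gamma + G) gives the coefficient of f as the limit of
sum_(|l| <= N) lambda_(k,l) f_l.  It remains to see that lambda_(k,l) vanishes
unless |k| <= |l| <= |k| + G.  Writing Psi = A(cos) + i sin B(cos), the
imaginary part of the pairing is odd, and the real part consists of moments
L(p) = int p(cos t) (1 + cos t)^d dt, to which orthogonality of Jacobi
polynomials to lower degrees applies: on the side of Psi_k if |l| < |k|, and on
the side of Psi_l, with (1 + cos t)^G absorbed in the other factor, if
|l| > |k| + G.

Orthogonality is derived from the explicit sum defining the polynomials. With
U = (X - 1)/2 and V = (X + 1)/2, integrating the derivative of
sin t * p(cos t) * (1 + cos t)^d relates L(U^i V^(j+1)) to L(U^(i+1) V^j), and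
pairing a Jacobi polynomial with V^j becomes an n-th finite difference of a
polynomial of degree less than n. All integrals that occur have d > 1/2, so the
integrands are continuous on the closed interval. *)
Require Import Defs.
From HB Require Import structures.
From mathcomp Require Import all_boot all_order all_algebra.
From mathcomp Require Import complex.
From mathcomp Require Import all_classical all_reals all_analysis.
From mathcomp Require Import finmap measurable_realfun.
From mathcomp Require Import zify ring lra.

Import Order.TTheory GRing.Theory Num.Theory.
Import numFieldNormedType.Exports.

Local Open Scope classical_set_scope.
Local Open Scope ring_scope.
Local Open Scope complex_scope.

(** * Finite differences and an affine change of variable *)

(** Pascal's rule: a difference of order n + 1 is the n-th difference of a first difference. *)
Lemma alternating_binomial_sumS (R : comNzRingType) (n : nat) (h : nat -> R) :
  \sum_(s < n.+2) (-1) ^+ s * 'C(n.+1, s)%:R * h s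
  = \sum_(s < n.+1) (-1) ^+ s * 'C(n, s)%:R * (h s - h s.+1).
Proof.
rewrite big_ord_recl expr0 bin0 !mul1r.
under eq_bigr => i _ do rewrite binS natrD exprS mulrDr mulrDl.
rewrite big_split /= addrA.
under [RHS]eq_bigr => i _ do rewrite mulrBr.
rewrite sumrB big_ord_recr /= bin_small// mulr0 mul0r addr0; congr (_ + _).
  rewrite [RHS]big_ord_recl expr0 bin0 !mul1r; congr (_ + _).
  by apply: eq_bigr => i _; rewrite -exprS.
by rewrite -sumrN; apply: eq_bigr => i _; rewrite -[bump 0 i]/(i.+1); ring.
Qed.

(** An n-th difference kills polynomials of degree below n. For rising factorials the induction is
    immediate: consecutive values share all but one factor, and a first difference is j + 1 times
    the rising factorial of length j with the same [c]. *)
Lemma alternating_binomial_sum_prod0 (R : comNzRingType) (n j : nat) (c : R) :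
  (j < n)%N ->
  \sum_(s < n.+1) (-1) ^+ s * 'C(n, s)%:R * \prod_(i < j) (c - s%:R + i%:R) = 0.
Proof.
elim: n j => // n IH j jn.
rewrite (alternating_binomial_sumS _ n (fun s => \prod_(i < j) (c - s%:R + i%:R))).
case: j jn => [_|j jn].
  by apply: big1 => s _; rewrite !big_ord0 subrr mulr0.
transitivity (j.+1%:R * \sum_(s < n.+1) (-1) ^+ s * 'C(n, s)%:R
                * \prod_(i < j) (c - s%:R + i%:R)); last by rewrite IH ?mulr0.
rewrite mulr_sumr; apply: eq_bigr => s _.
rewrite [X in X - _]big_ord_recr [X in _ - X]big_ord_recl /=.
under [X in _ - _ * X]eq_bigr => i _.
  rewrite -[bump 0 i]/(i.+1) (_ : _ + _ = c - s%:R + i%:R); last first.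
    by rewrite -!natr1; ring.
  over.
by rewrite -!natr1; ring.
Qed.

(** Allows a test polynomial to be expanded in powers of (X + 1)/2 without changing its degree; the
    inverse substitution is 2X - 1. *)
Lemma comp_half_addX1 (R : numFieldType) (q : {poly R}) :
  exists2 r : {poly R}, size r = size q & q = r \Po (2^-1 *: ('X + 1)).
Proof.
exists (q \Po (2 *: 'X - 1)).
  rewrite size_comp_poly2// size_polyDl ?size_scale ?size_polyX ?pnatr_eq0//.
  by rewrite size_polyN size_poly1.
rewrite -comp_polyA [X in q \Po X](_ : _ = 'X) ?comp_polyXr//.
rewrite comp_polyB comp_polyZ comp_polyX comp_polyC scalerA mulfV ?pnatr_eq0//.
by rewrite scale1r addrK.
Qed.

(** * Orthogonality of Jacobi polynomials from an abstract moment recurrence *)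

Section JacobiOrthogonality.
Context {R : realType}.
Local Notation U := (2^-1 *: ('X - 1) : {poly R}).
Local Notation V := (2^-1 *: ('X + 1) : {poly R}).

(** The recurrence, applied s times, trades s factors [V] for factors [U]. The form without division
    stays valid when some N + b - i vanishes. *)
Lemma moment_ratio (L : {poly R} -> R) (a b : R) (N s : nat) :
  (forall i j, (a + i%:R + 1) * L (U ^+ i * V ^+ j.+1)
             = - (b + j%:R + 1) * L (U ^+ i.+1 * V ^+ j)) ->
  (s <= N)%N ->
  L (U ^+ s * V ^+ (N - s)) * \prod_(i < s) (N%:R + b - i%:R)
  = (-1) ^+ s * \prod_(i < s) (a + i%:R + 1) * L (V ^+ N).
Proof.
move=> hL; elim: s => [|s IH] sN; first by rewrite !big_ord0 expr0 !mul1r subn0 mulr1.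
rewrite !big_ord_recr /= [(-1) ^+ _]exprS.
have := hL s (N - s.+1)%N; have := IH (ltnW sN); rewrite subnSK// => E1 E2.
have -> : N%:R + b - s%:R = b + (N - s.+1)%:R + 1.
  by rewrite natrB// -natr1; ring.
rewrite mulrA mulrAC.
transitivity (- ((a + s%:R + 1) * L (U ^+ s * V ^+ (N - s)))
   * \prod_(i < s) (N%:R + b - i%:R)).
  by rewrite E2; ring.
transitivity (- (a + s%:R + 1) * (L (U ^+ s * V ^+ (N - s))
   * \prod_(i < s) (N%:R + b - i%:R))); first by ring.
by rewrite E1; ring.
Qed.

(** Both sides are the product of the s + j consecutive numbers from c - s + 1 to c + j, cut after
    the first s on the left and after the first j on the right. *)
Lemma falling_prod_shift (c : R) (s j : nat) :
  \prod_(i < s) (c - i%:R) * \prod_(i < j) (c + i%:R + 1)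
  = \prod_(i < s) (c + j%:R - i%:R) * \prod_(i < j) (c - s%:R + i%:R + 1).
Proof.
elim: s => [|s IH].
  by rewrite !big_ord0 !mul1r; apply: eq_bigr => i _; rewrite subr0.
rewrite !big_ord_recr /= mulrAC IH -!mulrA; congr (_ * _).
case: j {IH} => [|j]; first by rewrite !big_ord0 addr0 mulr1 mul1r.
rewrite big_ord_recr [in RHS]big_ord_recl /=.
under [in RHS]eq_bigr => i _.
  rewrite -[bump 0 i]/(i.+1) (_ : _ + 1 = c - s%:R + i%:R + 1); last first.
    by rewrite -!natr1; ring.
  over.
by rewrite -!natr1; ring.
Qed.

(** The binomial supplies the factors a + s + 1, ..., a + n missing from the product. The result is
    independent of s, so it can be taken out of the sum defining the Jacobi polynomial. *)
Lemma gbinom_prod (a : R) (n s : nat) : (s <= n)%N ->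
  gbinom (n%:R + a) (n - s) * \prod_(i < s) (a + i%:R + 1) * (n - s)`!%:R
  = \prod_(i < n) (a + i%:R + 1).
Proof.
move=> sn; rewrite /gbinom mulrAC divfK; last by rewrite pnatr_eq0 -lt0n fact_gt0.
rewrite -[in RHS](subnKC sn) big_split_ord mulrC; congr (_ * _).
rewrite (reindex_inj rev_ord_inj); apply: eq_bigr => i _ /=.
rewrite -{1}(subnKC sn) natrD (natrB _ (ltn_ord i)) natrD -natr1; ring.
Qed.

(* L stands for the moment functional of (1 - r)^a (1 + r)^(b + G), so the factor
(1 + r)^G counts towards the degree of the test polynomial. *)
Lemma jacobi_orthogonal (L : {scalar {poly R}}) (a b : R) (G n : nat)
    (q : {poly R}) : -1 < b ->
  (forall i j, (a + i%:R + 1) * L (U ^+ i * V ^+ j.+1)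
             = - (b + G%:R + j%:R + 1) * L (U ^+ i.+1 * V ^+ j)) ->
  (size q + G <= n)%N -> L (jacobi a b n * q) = 0.
Proof.
move=> hb hL; have [r <- ->] := comp_half_addX1 _ q => sr.
rewrite comp_polyE mulr_sumr linear_sum big1// => j _.
rewrite -scalerAr linearZ /= [X in _ * X](_ : _ = 0) ?mulr0//.
have jGn : (j + G < n)%N by rewrite (leq_trans _ sr)// ltn_add2r.
rewrite /jacobi mulr_suml linear_sum /=.
(* [D] is positive since b > -1. Multiplication by it turns the s-th summand into [K] times the s-th
   term of an n-th difference of a polynomial in s of degree j + G < n. *)
set D := \prod_(i < j + G) (n%:R + b + i%:R + 1) * n`!%:R.
have D0 : D != 0.
  rewrite mulf_neq0 ?pnatr_eq0 -?lt0n ?fact_gt0//.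
  apply/prodf_neq0 => i _; rewrite gt_eqF//.
  have : 0 <= n%:R :> R by []. have : 0 <= i%:R :> R by []. lra.
apply/(mulfI D0); rewrite mulr0 mulr_sumr.
pose K := \prod_(i < n) (a + i%:R + 1) * L (V ^+ (n + j)).
transitivity (K * \sum_(s < n.+1) (-1) ^+ s * 'C(n, s)%:R
   * \prod_(i < j + G) (n%:R + b + 1 - s%:R + i%:R)); last first.
  by rewrite alternating_binomial_sum_prod0// mulr0.
rewrite mulr_sumr; apply: eq_bigr => s _.
have sn : (s <= n)%N by rewrite -ltnS ltn_ord.
rewrite -!(@scalerAl R {poly R}) -[_ * _ * V ^+ j]mulrA -exprD [L _]linearZ /=.
have M := @moment_ratio L a (b + G%:R) (n + j)%N s hL (leq_trans sn (leq_addr _ _)).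
rewrite -addnBAC// in M.
have F := falling_prod_shift (n%:R + b) s (j + G).
have B := gbinom_prod a n s sn.
have C : 'C(n, s)%:R * s`!%:R * (n - s)`!%:R = n`!%:R :> R.
  by rewrite -!natrM -mulnA bin_fact.
have -> : \prod_(i < j + G) (n%:R + b + 1 - s%:R + i%:R)
   = \prod_(i < j + G) (n%:R + b - s%:R + i%:R + 1).
  by apply: eq_bigr => i _; ring.
have E : \prod_(i < s) (n%:R + b + (j + G)%:R - i%:R)
  = \prod_(i < s) ((n + j)%:R + (b + G%:R) - i%:R).
  by apply: eq_bigr => i _; rewrite !natrD; ring.
rewrite E in F.
have P0 : \prod_(i < s) ((n + j)%:R + (b + G%:R) - i%:R) != 0.
  apply/prodf_neq0 => i _; rewrite gt_eqF//.
  have : i%:R + 1 <= n%:R :> R by rewrite natr1 ler_nat (leq_trans _ sn).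
  have : 0 <= j%:R :> R by []. have : 0 <= G%:R :> R by [].
  rewrite natrD; lra.
rewrite /K /D -B -C.
have -> : gbinom (n%:R + b) s = \prod_(i < s) (n%:R + b - i%:R) / s`!%:R by [].
have f0 : s`!%:R != 0 :> R by rewrite pnatr_eq0 -lt0n fact_gt0.
set pb := \prod_(i < s) (n%:R + b - i%:R) in F *.
set pj := \prod_(i < j + G) (n%:R + b + i%:R + 1) in F *.
set pm := \prod_(i < s) ((n + j)%:R + _ - i%:R) in F M P0 *.
set pk := \prod_(i < j + G) _ in F *.
set pa := \prod_(i < s) _ in M *.
set g := gbinom _ _.
(* [F] trades [pb * pj] for [pm * pk]: [pm] is the factor with which [M] evaluates the moment, and
   [pk] is the polynomial in s. *)
transitivity (g * 'C(n, s)%:R * (n - s)`!%:R * (pb * pj)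
  * L (U ^+ s * V ^+ (n - s + j))); first by field.
rewrite F.
transitivity (g * 'C(n, s)%:R * (n - s)`!%:R * pk
  * (L (U ^+ s * V ^+ (n - s + j)) * pm)); first by ring.
by rewrite M; ring.
Qed.

End JacobiOrthogonality.

(** * Moments of the weight (1 + cos t)^d and their recurrence *)

Section TrigonometricMoments.
Context {R : realType}.
Local Notation mu := (@lebesgue_measure R).
Local Notation itv := `[- pi, pi]%classic.
Local Notation U := (2^-1 *: ('X - 1) : {poly R}).
Local Notation V := (2^-1 *: ('X + 1) : {poly R}).
Implicit Types (d : R) (h : R -> R) (p : {poly R}).

Lemma addr1cos_ge0 (t : R) : 0 <= 1 + cos t.
Proof. by have := cos_geN1 t; lra. Qed.

Lemma addr1cos_gt0 (t : R) : t \in `]- pi, pi[ -> 0 < 1 + cos t.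
Proof.
rewrite in_itv/= => /andP[t1 t2]; rewrite [t](_ : _ = t / 2 + t / 2); last by field.
rewrite cosD -!expr2 sin2cos2.
have : 0 < cos (t / 2) by apply: cos_gt0_pihalf; apply/andP; split; lra.
by move=> /(exprn_gt0 2); lra.
Qed.

Lemma continuous_weight d : 0 < d -> continuous (weight d).
Proof.
move=> d0 t; rewrite /weight; have := addr1cos_ge0 t.
rewrite le_eqVlt => /predU1P[t0|t0]; last first.
  apply: (@continuous_comp _ _ _ (fun t => 1 + cos t) (fun x => x `^ d)).
    by apply: cvgD; [exact: cvg_cst|exact: continuous_cos].
  by apply/differentiable_continuous/derivable1_diffP/derivable_powR; rewrite in_itv/= t0.
(* At a zero of 1 + cos t the power is not differentiable in general; the bound e is reached once 1
   + cos s <= e^(1/d). *)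
rewrite /continuous_at -t0 powR0 ?gt_eqF//; apply/cvgr0Pnorm_le => e e0.
have c : (fun t => 1 + cos t) @ t --> 0.
  by rewrite t0; apply: cvgD; [exact: cvg_cst|exact: continuous_cos].
move/cvgr0Pnorm_le : c => /(_ (e `^ d^-1)) /(_ (powR_gt0 _ e0)).
apply: filterS => s; rewrite !ger0_norm ?powR_ge0 ?addr1cos_ge0// => se.
rewrite [e](_ : _ = (e `^ d^-1) `^ d); last by rewrite -powRrM mulVf ?gt_eqF// powRr1// ltW.
apply: (ge0_ler_powR (ltW d0)) => //; rewrite nnegrE ?addr1cos_ge0 ?powR_ge0//.
Qed.

Lemma continuous_horner_cos p : continuous (fun t => p.[cos t]).
Proof.
by move=> t; apply: continuous_comp; [exact: continuous_cos|exact: continuous_horner].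
Qed.

Lemma continuous_integrable h : continuous h -> mu.-integrable itv (EFin \o h).
Proof.
move=> ch; apply: continuous_compact_integrable; first exact: segment_compact.
exact: continuous_subspaceT.
Qed.

(** With r = cos t this is twice the integral of p against the Jacobi weight (1 - r)^(-1/2) (1 +
    r)^(d - 1/2). *)
Definition trig_moment d p : R := \int[mu]_(t in itv) (p.[cos t] * weight d t).

Lemma continuous_trig d p : 0 < d -> continuous (fun t => p.[cos t] * weight d t).
Proof.
by move=> d0 t; apply: cvgM; [exact: continuous_horner_cos|exact: continuous_weight].
Qed.

Lemma trig_moment_is_scalar d : 0 < d -> scalar (trig_moment d).
Proof.
move=> d0 c p q; rewrite /trig_moment -RintegralZl//; last first.
  exact/continuous_integrable/continuous_trig.
rewrite -RintegralD//.
- by apply: eq_Rintegral => t _; rewrite hornerD hornerZ; ring.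
- apply: continuous_integrable => t; apply: cvgM; first exact: cvg_cst.
  exact: continuous_trig.
- exact/continuous_integrable/continuous_trig.
Qed.

Lemma trig_moment_eq_scalar d : 0 < d ->
  exists L : {scalar {poly R}}, trig_moment d = L.
Proof.
move=> d0; pose L : {scalar {poly R}} := HB.pack (trig_moment d)
  (GRing.isLinear.Build R {poly R} R *%R (trig_moment d) (trig_moment_is_scalar d d0)).
by exists L.
Qed.

(* The integrand is the derivative of sin t * p(cos t) * (1 + cos t)^d. *)
Lemma trig_moment_ibp d p : 0 < d ->
  trig_moment d ('X * p - (1 - 'X ^+ 2) * p^`() - d *: ((1 - 'X) * p)) = 0.
Proof.
move=> d0; pose F t := sin t * p.[cos t] * weight d t.
have cF : continuous F.
  move=> t; rewrite /F; apply: cvgM; last exact: continuous_weight.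
  by apply: cvgM; [exact: continuous_sin|exact: continuous_horner_cos].
have dF (t : R) : 0 < 1 + cos t -> is_derive t 1 F
    (('X * p - (1 - 'X ^+ 2) * p^`() - d *: ((1 - 'X) * p)).[cos t] * weight d t).
  move=> t0.
  have dp : is_derive t 1 (fun t => p.[cos t]) (- sin t * p^`().[cos t]).
    have dh : is_derive (cos t) 1 (horner p) (p^`().[cos t]).
      by split; [exact: derivable_horner|rewrite -derive1E derivE].
    by have := @is_derive1_comp _ _ _ _ _ _ dh (is_derive_cos t); rewrite mulrC.
  have dw : is_derive t 1 (weight d) (- sin t * (d * (1 + cos t) `^ (d - 1))).
    have dc : is_derive t 1 (fun t => 1 + cos t) (- sin t).
      by rewrite -[- sin t]add0r; apply: is_deriveD.
    have := @is_derive1_comp _ _ (fun t : R => 1 + cos t) _ _ _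
      (@is_derive1_powR R d (1 + cos t) t0) dc.
    by rewrite mulrC.
  have := is_deriveM (is_deriveM (is_derive_sin t) dp) dw.
  move=> /is_derive_eq; apply.
  transitivity (sin t * p.[cos t] * (- sin t * (d * (1 + cos t) `^ (d - 1)))
    + (1 + cos t) `^ d * (sin t * (- sin t * p^`().[cos t]) + p.[cos t] * cos t)) => //.
  rewrite /weight !(hornerD, hornerN, hornerX, hornerC, horner_exp, hornerZ, hornerM).
  rewrite -(mulr_powRB1 (ltW t0) d0).
  (* The chain rule leaves (1 + cos t)^(d - 1) next to sin t ^ 2, whose factor 1 + cos t restores
     the exponent d. *)
  have s2 : sin t ^+ 2 = (1 - cos t) * (1 + cos t) by rewrite sin2cos2; ring.
  set w := _ `^ (d - 1).
  transitivity (cos t * p.[cos t] * ((1 + cos t) * w)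
     - sin t ^+ 2 * (p^`().[cos t] * ((1 + cos t) * w) + d * p.[cos t] * w)).
    by ring.
  by rewrite s2; ring.
have pi0 : - pi < pi :> R by have := pi_gt0 R; lra.
(* The derivative is known on the open interval, where 1 + cos t > 0; at the end points continuity
   of [F] suffices, and sin vanishes there. *)
rewrite /trig_moment /Rintegral (@continuous_FTC2 _ _ F)//.
- by rewrite /F sinN sinpi !mul0r oppr0 !mul0r subee.
- by apply: continuous_subspaceT; exact: continuous_trig.
- split; first by move=> t /addr1cos_gt0 /dF [].
  + by apply: cvg_at_right_filter; exact: cF.
  + by apply: cvg_at_left_filter; exact: cF.
- by move=> t /addr1cos_gt0 /dF [_ <-]; rewrite derive1E.
Qed.

Lemma odd_Rintegral0 h : continuous h -> (forall t, h (- t) = - h t) ->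
  \int[mu]_(t in itv) h t = 0.
Proof.
move=> ch oh; have pi0 : - pi <= pi :> R by have := pi_gt0 R; lra.
have E : \int[mu]_(t in itv) h t = \int[mu]_(t in itv) (-1 * h t).
  rewrite /Rintegral; congr fine; rewrite -{2}[pi]opprK.
  rewrite integration_by_substitution_oppr//; last first.
    exact: continuous_subspaceT.
  by apply: eq_integral => t _ /=; rewrite oh mulN1r.
by move: E; rewrite RintegralZl//; [lra|exact: continuous_integrable].
Qed.

(** Integration by parts with p = U^i V^j, after X = U + V, 1 - X = -2U and 1 - X^2 = -4UV. This is
    the recurrence required by [jacobi_orthogonal] for a = -1/2 and b + G = d - 1/2. *)
Lemma trig_moment_ratio d i j : 0 < d ->
  (i%:R + 2^-1) * trig_moment d (U ^+ i * V ^+ j.+1)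
  = - (j%:R + d + 2^-1) * trig_moment d (U ^+ i.+1 * V ^+ j).
Proof.
move=> d0.
have [L LE] := trig_moment_eq_scalar d d0.
have := trig_moment_ibp d (U ^+ i * V ^+ j) d0.
have hh : (2^-1)%:P * 2 = 1 :> {poly R}.
  by rewrite -(rmorph_nat (@polyC R)) -polyCM mulVf// pnatr_eq0.
have dU : U^`() = (2^-1)%:P by rewrite derivZ derivB derivX derivC subr0 alg_polyC.
have dV : V^`() = (2^-1)%:P by rewrite derivZ derivD derivX derivC addr0 alg_polyC.
have UV : 1 - 'X ^+ 2 = - 4 * (U * V) :> {poly R}.
  rewrite -!mul_polyC; transitivity (((2^-1)%:P * 2) ^+ 2 * (1 - 'X ^+ 2) : {poly R}).
    by rewrite hh expr1n mul1r.
  by ring.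
have XUV : 'X = U + V.
  rewrite -!mul_polyC; transitivity ((2^-1)%:P * 2 * 'X : {poly R}); first by rewrite hh mul1r.
  by ring.
(* The extra factor [U] avoids the exponent i - 1, so that i = 0 is covered; the 2 cancels the
   derivative 1/2 of [U]. *)
have DU : U * (U ^+ i)^`() *+ 2 = i%:R * U ^+ i.
  rewrite deriv_exp dU; case: (i) => [|k]; first by rewrite !mulr0n mulr0 mul0rn mul0r.
  set x := U; transitivity ((2^-1)%:P * 2 * (k.+1%:R * x ^+ k.+1)); last by rewrite hh mul1r.
  by rewrite exprS -pred_Sn -mulr_natr -[in LHS]mulr_natr; ring.
have DV : V * (V ^+ j)^`() *+ 2 = j%:R * V ^+ j.
  rewrite deriv_exp dV; case: (j) => [|k]; first by rewrite !mulr0n mulr0 mul0rn mul0r.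
  set x := V; transitivity ((2^-1)%:P * 2 * (k.+1%:R * x ^+ k.+1)); last by rewrite hh mul1r.
  by rewrite exprS -pred_Sn -mulr_natr -[in LHS]mulr_natr; ring.
have U2 : 1 - 'X = - 2 * U :> {poly R}.
  rewrite -!mul_polyC; transitivity ((2^-1)%:P * 2 * (1 - 'X) : {poly R}).
    by rewrite hh mul1r.
  by ring.
rewrite (_ : _ - _ = (2 * (i%:R + 2^-1)) *: (U ^+ i * V ^+ j.+1)
   + (2 * (j%:R + d + 2^-1)) *: (U ^+ i.+1 * V ^+ j)).
  rewrite LE linearP linearZ /= => h.
  by apply: (mulfI (@mulf_neq0 R 2 1 _ _)); rewrite ?pnatr_eq0//; lra.
set x := U in DU UV U2 XUV *; set y := V in DV UV XUV *.
rewrite derivM UV U2 XUV !exprS.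
rewrite -[d *: _]mul_polyC -[(2 * (i%:R + _)) *: _]mul_polyC.
rewrite -[(2 * (j%:R + d + _)) *: _]mul_polyC !polyCM !rmorph_nat !polyCD !rmorph_nat.
transitivity (((x + y) * (x ^+ i * y ^+ j) + 2 * y * (x * (x ^+ i)^`() *+ 2) * y ^+ j
  + 2 * x * (y * (y ^+ j)^`() *+ 2) * x ^+ i) + 2 * d%:P * x * x ^+ i * y ^+ j).
  by ring.
rewrite DU DV; transitivity (
  (2 * i%:R + (2^-1)%:P * 2) * (x ^+ i * (y * y ^+ j))
  + (2 * j%:R + 2 * d%:P + (2^-1)%:P * 2) * (x * x ^+ i * y ^+ j)); last by ring.
by rewrite hh; ring.
Qed.
End TrigonometricMoments.

(** * Vanishing of the connection coefficients *)

Section Connection.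
Context {R : realType}.
Local Notation mu := (@lebesgue_measure R).
Local Notation itv := `[- pi, pi]%classic.
Local Notation U := (2^-1 *: ('X - 1) : {poly R}).
Local Notation V := (2^-1 *: ('X + 1) : {poly R}).
Implicit Types (a b d e : R) (p q : {poly R}) (k l : int).

Lemma size_jacobi a b n : (size (jacobi a b n) <= n.+1)%N.
Proof.
have s1 c : (size (2^-1 *: ('X + c%:P) : {poly R}) <= 2)%N.
  by rewrite (leq_trans (size_scale_leq _ _))// size_XaddC.
have se c (s : nat) : (size ((2^-1 *: ('X + c%:P) : {poly R}) ^+ s) <= s.+1)%N.
  rewrite (leq_trans (size_poly_exp_leq _ _))// ltnS -[leqRHS]mul1n leq_mul2r.
  by apply/orP; right; have := s1 c; case: size.
rewrite /jacobi; apply: (leq_trans (size_sum _ _ _)); apply/bigmax_leqP => s _.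
rewrite (leq_trans (size_scale_leq _ _))// (leq_trans (size_polyMleq _ _))//.
have := se (-1) s; rewrite polyCN => h1; have h2 := se 1 (n - s)%N.
rewrite -subn1 leq_subLR add1n (leq_trans (leq_add h1 h2))//.
by rewrite addSn addnS subnKC// -ltnS.
Qed.

Lemma jacobi_orthogonal_even d e (G n : nat) q : - 2^-1 < e -> 0 < d ->
  e + G%:R = d -> (size q + G <= n)%N ->
  trig_moment d (jacobi (- 2^-1) (e - 2^-1) n * q) = 0.
Proof.
move=> he d0 ed sq; have [L LE] := trig_moment_eq_scalar d d0; rewrite LE.
apply: (@jacobi_orthogonal _ L) sq; first lra.
move=> i j; rewrite -LE; have := trig_moment_ratio d i j d0; rewrite -ed => h.
transitivity ((i%:R + 2^-1) * trig_moment (e + G%:R) (U ^+ i * V ^+ j.+1)).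
  by congr (_ * _); field.
by rewrite h; congr (_ * _); field.
Qed.

(** The factor 1 - X^2 = -4UV raises both exponents of the Jacobi weight by one, so the recurrence
    is used with i and j shifted by one. *)
Lemma jacobi_orthogonal_odd d e (G n : nat) q : - 2^-1 < e -> 0 < d ->
  e + G%:R = d -> (size q + G <= n)%N ->
  trig_moment d ((1 - 'X ^+ 2) * (jacobi 2^-1 (e + 2^-1) n * q)) = 0.
Proof.
move=> he d0 ed sq; have [L LE] := trig_moment_eq_scalar d d0.
pose L1 q := L ((1 - 'X ^+ 2) * q).
have L1s : scalar L1 by move=> c p r; rewrite /L1 mulrDr -scalerAr linearP.
pose L2 : {scalar {poly R}} := HB.pack L1 (GRing.isLinear.Build R {poly R} R *%R L1 L1s).
rewrite LE -[LHS]/(L2 _).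
apply: (@jacobi_orthogonal _ L2) sq; first lra.
move=> i j; rewrite /= /L1.
have UV (p r : {poly R}) : (1 - 'X ^+ 2) * (p * r) = (- 4) *: ((U * p) * (V * r)).
  rewrite -!(scalerAl, scalerAr) !scalerA -mul_polyC.
  rewrite (_ : _ * _ * _ = -1); last by field.
  by rewrite polyCN; ring.
rewrite !UV -!exprS !linearZ /= -LE; have := trig_moment_ratio d i.+1 j.+1 d0.
rewrite -ed => h.
transitivity (- 4 * ((i.+1%:R + 2^-1) * trig_moment (e + G%:R) (U ^+ i.+1 * V ^+ j.+2))).
  by rewrite -natr1; field.
by rewrite h -!natr1; field.
Qed.

Definition trig_fun p q (t : R) : R[i] := p.[cos t] +i* (sin t * q.[cos t]).

(** Norms and signs are absorbed into [x] and [y]. The case k = 0 is separate: the predecessor of 0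
    is 0, yet there is no sine part. *)
Lemma Psi_trig_fun e k : exists x y : R,
  Psi e k = trig_fun (x *: jacobi (- 2^-1) (e - 2^-1) `|k|%N)
    (if k == 0 then 0 else y *: jacobi 2^-1 (e + 2^-1) `|k|%N.-1).
Proof.
rewrite /Psi /jacobi_normalized; case: eqVneq => [->|k0].
  exists ((Num.sqrt 2)^-1 / jacobi_norm (- 2^-1) (e - 2^-1) 0), 0.
  apply/funext => t; rewrite /trig_fun hornerZ horner0 mulr0 /=.
  by simpc; congr (_ +i* _); ring.
exists (2^-1 / jacobi_norm (- 2^-1) (e - 2^-1) `|k|%N),
  (2^-1 * (sgz k)%:~R / jacobi_norm 2^-1 (e + 2^-1) `|k|%N.-1).
apply/funext => t; rewrite /trig_fun !hornerZ -(rmorph_int (real_complex R)) /=.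
by simpc; congr (_ +i* _); ring.
Qed.

Lemma inner_trig_fun d p q p' q' : 0 < d ->
  inner (weight d) (trig_fun p q) (trig_fun p' q')
  = (trig_moment d (p * p') + trig_moment d ((1 - 'X ^+ 2) * (q * q')))%:C.
Proof.
move=> d0; rewrite /inner /trig_fun /=.
congr (_ +i* _).
  rewrite /trig_moment -RintegralD//; [|exact/continuous_integrable/continuous_trig..].
  apply: eq_Rintegral => t _; rewrite !(hornerD, hornerN, hornerM, horner_exp, hornerX, hornerC).
  by rewrite -sin2cos2; ring.
(* The imaginary part is sin t times an even function. *)
rewrite [LHS](_ : _ = \int[mu]_(t in itv) (sin t * ((q * p' - p * q').[cos t] * weight d t))).
  apply: odd_Rintegral0 => t.
    by apply: cvgM; [exact: continuous_sin|exact: continuous_trig].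
  by rewrite /weight sinN cosN mulNr.
apply: eq_Rintegral => t _; rewrite !(hornerD, hornerN, hornerM); ring.
Qed.

Lemma lambda_eq0 (gamma : R) (G : nat) k l : - 2^-1 < gamma -> 0 < gamma + G%:R ->
  ~~ (`|k| <= `|l| <= `|k| + G)%N -> lambda gamma G k l = 0.
Proof.
move=> hg d0; rewrite /lambda.
have [x [y ->]] := Psi_trig_fun gamma l.
have [x' [y' ->]] := Psi_trig_fun (gamma + G%:R) k.
have gG : - 2^-1 < gamma + G%:R by rewrite (lt_trans _ d0)// oppr_lt0 invr_gt0.
have sJ c a b n : (size (c *: jacobi a b n) <= n.+1)%N.
  by rewrite (leq_trans (size_scale_leq _ _))// size_jacobi.
have tm0 : trig_moment (gamma + G%:R) 0 = 0.
  by have [L ->] := trig_moment_eq_scalar _ d0; rewrite linear0.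
rewrite inner_trig_fun// negb_and -!ltnNge => /orP[lk|kl].
(* Case |l| < |k|: the polynomials of Psi_k have degree indices |k| and |k| - 1, and its own weight
   is used, hence G := 0. *)
- rewrite mulrC -scalerAl scalerAr (@jacobi_orthogonal_even _ _ 0)//; last 2 first.
  + by rewrite addr0.
  + by rewrite addn0 (leq_trans (size_scale_leq _ _))// (leq_trans (sJ _ _ _ _)).
  have -> : (k == 0) = false by case: (k) lk => -[].
  rewrite [X in _ * X]mulrC -scalerAl scalerAr (@jacobi_orthogonal_odd _ _ 0)//; last 2 first.
  + by rewrite addr0.
  + rewrite addn0 (leq_trans (size_scale_leq _ _))//; case: eqVneq => [_|l0].
      by rewrite size_poly0.
    by rewrite (leq_trans (sJ _ _ _ _))//; lia.
  by rewrite addr0.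
(* Case |l| > |k| + G: now the polynomials of Psi_l are orthogonal, and the surplus (1 + cos t)^G
   costs G degrees on the side of Psi_k. *)
- rewrite -scalerAl scalerAr (@jacobi_orthogonal_even _ gamma G)//; last first.
    rewrite (leq_trans _ kl)// -addSn leq_add2r.
    by rewrite (leq_trans (size_scale_leq _ _))// (leq_trans (sJ _ _ _ _)).
  have -> : (l == 0) = false by case: (l) kl => -[].
  rewrite -scalerAl scalerAr (@jacobi_orthogonal_odd _ gamma G)//; last first.
    case: eqVneq => [k0|k0]; first by rewrite scaler0 size_poly0 add0n; lia.
    rewrite (leq_trans (leq_add (leq_trans (size_scale_leq _ _) (sJ _ _ _ _)) (leqnn G)))//.
    by lia.
  by rewrite addr0.
Qed.
End Connection.

(** * Integrability, bounds and linearity of the weighted pairing *)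

Section WeightedInner.
Context {R : realType}.
Local Notation mu := (@lebesgue_measure R).
Local Notation itv := `[- pi, pi]%classic.
Local Notation normc := ComplexField.Normc.normc.
Implicit Types (h : R -> R) (w : R -> R) (f g : R -> R[i]).

Lemma sqr_normc_Re_Im (z : R[i]) :
  normc z ^+ 2 = complex.Re z ^+ 2 + complex.Im z ^+ 2.
Proof. by case: z => a b /=; rewrite sqr_sqrtr// addr_ge0 ?sqr_ge0. Qed.

Definition cmeasurable f := measurable_fun itv (fun t => complex.Re (f t)) /\
  measurable_fun itv (fun t => complex.Im (f t)).

Lemma in_L2_cmeasurable {w f} : in_L2 w f -> cmeasurable f.
Proof. by case. Qed.

Lemma cmeasurable_submul f g (c : R[i]) : cmeasurable f -> cmeasurable g ->
  cmeasurable (fun t => f t - c * g t).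
Proof.
case: c => a b [mf1 mf2] [mg1 mg2]; split.
- apply: (@eq_measurable_fun _ _ _ _ _ (fun t => complex.Re (f t) -
    (a * complex.Re (g t) - b * complex.Im (g t)))).
    by move=> t _; case: (f t) => ? ?; case: (g t).
  by apply: measurable_funB => //; apply: measurable_funB; apply: measurable_funM.
- apply: (@eq_measurable_fun _ _ _ _ _ (fun t => complex.Im (f t) -
    (a * complex.Im (g t) + b * complex.Re (g t)))).
    by move=> t _; case: (f t) => ? ?; case: (g t).
  by apply: measurable_funB => //; apply: measurable_funD; apply: measurable_funM.
Qed.

Lemma measurable_sqnorm w f : measurable_fun itv w -> cmeasurable f ->
  measurable_fun itv (fun t => normc (f t) ^+ 2 * w t).
Proof.
move=> mw [m1 m2].
rewrite (_ : (fun t => _) = fun t =>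
  (complex.Re (f t) ^+ 2 + complex.Im (f t) ^+ 2) * w t); last first.
  by apply/funext => t; rewrite sqr_normc_Re_Im.
apply: measurable_funM => //; apply: measurable_funD; exact: measurable_funX.
Qed.

Lemma integrable_sqnorm w f : measurable_fun itv w -> (forall t, 0 <= w t) ->
  in_L2 w f -> mu.-integrable itv (EFin \o (fun t => normc (f t) ^+ 2 * w t)).
Proof.
move=> mw w0 [m1 m2 foo]; apply/integrableP; split.
  by apply/measurable_EFinP; exact: measurable_sqnorm.
apply: le_lt_trans foo; rewrite le_eqVlt; apply/orP; left; apply/eqP.
by apply: eq_integral => t _; rewrite /= ger0_norm// mulr_ge0// sqr_ge0.
Qed.

Lemma integrable_lin h1 h2 (a b : R) :
  mu.-integrable itv (EFin \o h1) -> mu.-integrable itv (EFin \o h2) ->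
  mu.-integrable itv (EFin \o (fun t => a * h1 t + b * h2 t)).
Proof.
move=> i1 i2; have := integrableD _ (integrableZl _ a i1) (integrableZl _ b i2).
by apply => //.
Qed.

Lemma Rintegral_lin h1 h2 (a b : R) :
  mu.-integrable itv (EFin \o h1) -> mu.-integrable itv (EFin \o h2) ->
  \int[mu]_(t in itv) (a * h1 t + b * h2 t)
  = a * \int[mu]_(t in itv) h1 t + b * \int[mu]_(t in itv) h2 t.
Proof.
move=> i1 i2; rewrite RintegralD ?RintegralZl//.
- exact: (integrableZl _ a i1).
- exact: (integrableZl _ b i2).
Qed.

(** Linearity of [inner] relies on both integrals converging, since [fine] sends an infinite
    integral to 0. *)
Definition inner_integrable w f g :=
  mu.-integrable itv (EFin \o (fun t => complex.Re (f t * conjc (g t) * (w t)%:C))) /\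
  mu.-integrable itv (EFin \o (fun t => complex.Im (f t * conjc (g t) * (w t)%:C))).

Lemma dominated_Rintegral h1 h2 h (e : R) : 0 < e ->
  mu.-integrable itv (EFin \o h1) -> mu.-integrable itv (EFin \o h2) ->
  measurable_fun itv h ->
  (forall t, `|h t| <= e^-1 / 2 * h1 t + e / 2 * h2 t) ->
  mu.-integrable itv (EFin \o h) /\
  `|\int[mu]_(t in itv) h t|
  <= e^-1 / 2 * \int[mu]_(t in itv) h1 t + e / 2 * \int[mu]_(t in itv) h2 t.
Proof.
move=> e0 i1 i2 mh hh; have i12 := integrable_lin h1 h2 (e^-1 / 2) (e / 2) i1 i2.
have ih : mu.-integrable itv (EFin \o h).
  apply: le_integrable i12 => //; first exact/measurable_EFinP.
  by move=> t _; rewrite /= lee_fin (le_trans (hh t))// ler_norm.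
split=> //; rewrite -Rintegral_lin//; apply: (le_trans (le_normr_Rintegral _ _)) => //.
by apply: le_Rintegral => //; exact: (integrable_abse ih).
Qed.

(** Young's inequality with parameter e takes the place of Cauchy-Schwarz: a pointwise bound gives
    integrability and the estimate together. *)
Lemma inner_bound w f g (e : R) : 0 < e ->
  measurable_fun itv w -> (forall t, 0 <= w t) -> in_L2 w f -> in_L2 w g ->
  let M := e^-1 / 2 * \int[mu]_(t in itv) (normc (f t) ^+ 2 * w t)
         + e / 2 * \int[mu]_(t in itv) (normc (g t) ^+ 2 * w t) in
  [/\ inner_integrable w f g, `|complex.Re (inner w f g)| <= M &
      `|complex.Im (inner w f g)| <= M].
Proof.
move=> e0 mw w0 Lf Lg M.
have [f1 f2 _] := Lf; have [g1 g2 _] := Lg.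
have If := integrable_sqnorm w f mw w0 Lf; have Ig := integrable_sqnorm w g mw w0 Lg.
have amgm (x y x' y' v : R) : 0 <= v -> `|(x * x' + y * y') * v|
    <= e^-1 / 2 * ((x ^+ 2 + y ^+ 2) * v) + e / 2 * ((x' ^+ 2 + y' ^+ 2) * v).
  move=> v0; rewrite normrM (ger0_norm v0) !mulrA -mulrDl ler_wpM2r//.
  have k (s : R) : s ^+ 2 = 1 -> s * (x * x' + y * y')
      <= e^-1 / 2 * (x ^+ 2 + y ^+ 2) + e / 2 * (x' ^+ 2 + y' ^+ 2).
    move=> s1; rewrite -subr_ge0.
    (* Completed squares; s = 1 and s = -1 give the two halves of the absolute value. *)
    rewrite (_ : _ - _ = (e^-1 / 2) * ((x - s * e * x') ^+ 2 + (y - s * e * y') ^+ 2)).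
      by rewrite mulr_ge0 ?addr_ge0 ?sqr_ge0// divr_ge0// invr_ge0 ltW.
    transitivity (e^-1 / 2 * (x ^+ 2 + y ^+ 2) + (s ^+ 2) * (e / 2 * (x' ^+ 2 + y' ^+ 2))
       - s * (x * x' + y * y')); first by rewrite s1; ring.
    by field; rewrite gt_eqF.
  rewrite ler_norml lerNl; have := k 1; have := k (-1); rewrite sqrrN expr1n !mul1r mulN1r.
  by move=> /(_ erefl) -> /(_ erefl) ->.
have mRe : measurable_fun itv (fun t => (complex.Re (f t) * complex.Re (g t)
    + complex.Im (f t) * complex.Im (g t)) * w t).
  by apply: measurable_funM => //; apply: measurable_funD; exact: measurable_funM.
have mIm : measurable_fun itv (fun t => (complex.Im (f t) * complex.Re (g t)
    + complex.Re (f t) * - complex.Im (g t)) * w t).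
  apply: measurable_funM => //; apply: measurable_funD; apply: measurable_funM => //.
  exact: measurableT_comp.
have ERe t : complex.Re (f t * conjc (g t) * (w t)%:C) = (complex.Re (f t) * complex.Re (g t)
    + complex.Im (f t) * complex.Im (g t)) * w t.
  by case: (f t) => ? ?; case: (g t) => ? ? /=; ring.
have EIm t : complex.Im (f t * conjc (g t) * (w t)%:C) = (complex.Im (f t) * complex.Re (g t)
    + complex.Re (f t) * - complex.Im (g t)) * w t.
  by case: (f t) => ? ?; case: (g t) => ? ? /=; ring.
have [] := dominated_Rintegral _ _ _ e e0 If Ig mRe.
  by move=> t; rewrite !sqr_normc_Re_Im; exact: amgm.
have [] := dominated_Rintegral _ _ _ e e0 If Ig mIm.
  by move=> t; rewrite !sqr_normc_Re_Im -[complex.Im (g t) ^+ 2]sqrrN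
    [X in e^-1 / 2 * (X * _)]addrC; exact: amgm.
move=> I2 B2 I1 B1; rewrite /inner_integrable /inner /=.
by rewrite (funext ERe) (funext EIm).
Qed.

Lemma inner_submul w f1 f2 g (c : R[i]) :
  inner_integrable w f1 g -> inner_integrable w f2 g ->
  inner_integrable w (fun t => f1 t - c * f2 t) g /\
  inner w (fun t => f1 t - c * f2 t) g = inner w f1 g - c * inner w f2 g.
Proof.
case: c => a b [i1 i2] [j1 j2].
have ERe t : complex.Re ((f1 t - (a +i* b) * f2 t) * conjc (g t) * (w t)%:C)
  = 1 * complex.Re (f1 t * conjc (g t) * (w t)%:C) + -1 *
    (a * complex.Re (f2 t * conjc (g t) * (w t)%:C) +
     - b * complex.Im (f2 t * conjc (g t) * (w t)%:C)).
  by case: (f1 t) => ? ?; case: (f2 t) => ? ?; case: (g t) => ? ? /=; ring.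
have EIm t : complex.Im ((f1 t - (a +i* b) * f2 t) * conjc (g t) * (w t)%:C)
  = 1 * complex.Im (f1 t * conjc (g t) * (w t)%:C) + -1 *
    (a * complex.Im (f2 t * conjc (g t) * (w t)%:C) +
     b * complex.Re (f2 t * conjc (g t) * (w t)%:C)).
  by case: (f1 t) => ? ?; case: (f2 t) => ? ?; case: (g t) => ? ? /=; ring.
have k1 := integrable_lin _ _ a (- b) j1 j2; have k2 := integrable_lin _ _ a b j2 j1.
rewrite /inner_integrable /inner; rewrite (funext ERe) (funext EIm).
have k1' := integrable_lin _ _ 1 (-1) i1 k1; have k2' := integrable_lin _ _ 1 (-1) i2 k2.
split => //; rewrite !Rintegral_lin//.
by apply/eqP; rewrite eq_complex /=; apply/andP; split; apply/eqP; ring.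
Qed.

Lemma inner_sub_sum w f g (I : Type) (s : seq I) (c : I -> R[i]) (F : I -> R -> R[i]) :
  inner_integrable w f g -> (forall i, inner_integrable w (F i) g) ->
  inner w (fun t => f t - \sum_(i <- s) c i * F i t) g
  = inner w f g - \sum_(i <- s) c i * inner w (F i) g.
Proof.
move=> If IF; elim: s f If => [|i s IH] f If.
  by rewrite big_nil subr0; congr inner; apply/funext => t; rewrite big_nil subr0.
have [I1 E1] := inner_submul _ _ _ _ (c i) If (IF i).
rewrite big_cons opprD addrA -E1 -IH//; congr inner; apply/funext => t.
by rewrite big_cons opprD addrA.
Qed.

Lemma cmeasurable_sub_sum f (I : Type) (s : seq I) (c : I -> R[i]) (F : I -> R -> R[i]) :
  cmeasurable f -> (forall i, cmeasurable (F i)) ->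
  cmeasurable (fun t => f t - \sum_(i <- s) c i * F i t).
Proof.
move=> mf mF; elim: s f mf => [|i s IH] f mf.
  rewrite (_ : (fun t => _) = f)//; apply/funext => t.
  by rewrite big_nil subr0.
rewrite (_ : (fun t => _) = fun t => f t - c i * F i t - \sum_(i <- s) c i * F i t).
  by apply: IH; exact: cmeasurable_submul.
by apply/funext => t; rewrite big_cons opprD addrA.
Qed.

End WeightedInner.

(** * Comparison of the two weighted spaces *)

Section Comparison.
Context {R : realType}.
Local Notation itv := `[- pi, pi]%classic.
Local Notation normc := ComplexField.Normc.normc.

Lemma measurable_weight (d : R) (D : set R) : measurable D -> measurable_fun D (weight d).
Proof.
move=> mD; apply: (measurable_funS measurableT) => //.
apply: (@measurableT_comp _ _ _ _ _ _ (fun x : R => x `^ d) setT (fun t => 1 + cos t)) => //.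
apply: continuous_measurable_fun => t.
by apply: cvgD; [exact: cvg_cst|exact: continuous_cos].
Qed.

Lemma cmeasurable_trig_fun (p q : {poly R}) : cmeasurable (trig_fun p q).
Proof.
split; apply: (measurable_funS measurableT) => //; apply: continuous_measurable_fun.
  exact: continuous_horner_cos.
move=> t; apply: cvgM; [exact: continuous_sin|exact: continuous_horner_cos].
Qed.

Lemma cmeasurable_Psi (e : R) k : cmeasurable (Psi e k).
Proof. by have [x [y ->]] := Psi_trig_fun e k; exact: cmeasurable_trig_fun. Qed.

(** The squared modulus of Psi is a polynomial in cos t, so its product with the weight is
    continuous. As d and e are independent, both families lie in the second space. *)
Lemma in_L2_Psi (d e : R) k : 0 < d -> in_L2 (weight d) (Psi e k).
Proof.
move=> d0; have [m1 m2] := cmeasurable_Psi e k; split=> //.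
have [x [y ->]] := Psi_trig_fun e k; rewrite /sqnorm.
set p := x *: _; set q := (X in trig_fun _ X).
have c : continuous (fun t : R => (p ^+ 2 + (1 - 'X ^+ 2) * q ^+ 2).[cos t] * weight d t).
  exact: continuous_trig.
have /integrableP[_] := continuous_integrable _ c; apply: le_lt_trans.
rewrite le_eqVlt; apply/orP; left; apply/eqP; apply: eq_integral => t _ /=.
rewrite ger0_norm.
  congr (_ * _)%:E; rewrite sqr_sqrtr ?addr_ge0 ?sqr_ge0//.
  rewrite !(hornerD, hornerN, hornerM, horner_exp, hornerX, hornerC) -sin2cos2; ring.
rewrite mulr_ge0 ?powR_ge0// !(hornerD, hornerN, hornerM, horner_exp, hornerX, hornerC).
by rewrite -sin2cos2 -exprMn addr_ge0 ?sqr_ge0.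
Qed.

Lemma weight_le (gamma : R) (G : nat) (t : R) : 0 < gamma + G%:R ->
  weight (gamma + G%:R) t <= 2 ^+ G * weight gamma t.
Proof.
move=> d0; rewrite /weight; have := addr1cos_ge0 t; have := cos_le1 t => c1.
(* Where 1 + cos t = 0 the left side is 0; the right side is nonnegative even for negative [gamma],
   where [powR] takes the value 0. *)
rewrite le_eqVlt => /predU1P[<-|c0].
  by rewrite powR0 ?gt_eqF// mulr_ge0 ?exprn_ge0 ?powR_ge0.
rewrite powRD; last by rewrite (gt_eqF c0) implybT.
rewrite (powR_mulrn _ (ltW c0)) mulrC ler_wpM2r ?powR_ge0//.
by apply: lerXn2r; rewrite ?nnegrE; lra.
Qed.

Lemma sqnorm_le (gamma : R) (G : nat) (f : R -> R[i]) : 0 < gamma + G%:R ->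
  cmeasurable f ->
  (sqnorm (weight (gamma + G%:R)) f <= (2 ^+ G)%:E * sqnorm (weight gamma) f)%E.
Proof.
move=> d0 mf; rewrite /sqnorm.
have ms e : measurable_fun itv (fun t => (normc (f t) ^+ 2 * weight e t)%:E).
  by apply/measurable_EFinP; apply: measurable_sqnorm => //; exact: measurable_weight.
have s0 e t : (0 <= (normc (f t) ^+ 2 * weight e t)%:E)%E.
  by rewrite lee_fin mulr_ge0 ?sqr_ge0 ?powR_ge0.
rewrite -ge0_integralZl//; last exact: ms.
apply: ge0_le_integral => //.
- exact: ms.
- by apply: measurable_funeM; exact: ms.
- move=> t _; rewrite lee_fin mulrCA ler_wpM2l ?sqr_ge0//.
  exact: weight_le.
Qed.

Lemma finite_absz_le (N : nat) : finite_set [set k : int | (`|k| <= N)%N].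
Proof.
apply: (@sub_finite_set _ _ ((fun n : nat => n%:Z) @` `I_N.+1 `|` (fun n : nat => - n%:Z) @` `I_N.+1)).
  move=> k /= kN; have [k0|k0] := leP 0 k; [left|right].
    by exists `|k|%N => //=; lia.
  by exists `|k|%N => //=; lia.
by rewrite finite_setU; split; apply: finite_image; exact: finite_II.
Qed.

End Comparison.

(** * Passage to the limit in the first expansion *)

Theorem proposition2 (R : realType) (gamma : R) (G : nat) (f : R -> R[i])
    (hgamma : - 2^-1 < gamma) (hG : (0 < G)%N)
    (hf : in_L2 (weight gamma) f)
    (hfG : in_L2 (weight (gamma + G%:R)) f)
    (hexp : L2_expansion (weight gamma) f (coef gamma f) (Psi gamma))
    (hexpG : L2_expansion (weight (gamma + G%:R)) f
               (coef (gamma + G%:R) f) (Psi (gamma + G%:R))) :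
  forall k : int,
    coef (gamma + G%:R) f k =
    \sum_(l \in [set l : int | (`|k| <= `|l| <= `|k| + G)%N])
       lambda gamma G k l * coef gamma f l.
Proof.
move=> k; set S := (RHS).
have d0 : 0 < gamma + G%:R.
  have : 1 <= G%:R :> R by rewrite ler1n.
  by lra.
have mw : measurable_fun `[- pi, pi]%classic (weight (gamma + G%:R)).
  exact: measurable_weight.
have w0 t : 0 <= weight (gamma + G%:R) t by exact: powR_ge0.
pose r N t := f t - \sum_(l \in [set l : int | (`|l| <= N)%N]) coef gamma f l * Psi gamma l t.
have rE N : r N = fun t => f t -
    \sum_(l <- fset_set [set l : int | (`|l| <= N)%N]) coef gamma f l * Psi gamma l t.
  by apply/funext => t; rewrite /r fsbig_finite//; exact: finite_absz_le.
have mr N : cmeasurable (r N).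
  rewrite rE; apply: cmeasurable_sub_sum; first exact: in_L2_cmeasurable hf.
  by move=> l; exact: cmeasurable_Psi.
have LPsi e l : in_L2 (weight (gamma + G%:R)) (Psi e l) by exact: in_L2_Psi.
have If g : in_L2 (weight (gamma + G%:R)) g ->
    inner_integrable (weight (gamma + G%:R)) g (Psi (gamma + G%:R) k).
  by move=> Lg; have [] := inner_bound _ g (Psi (gamma + G%:R) k) 1 ltr01 mw w0 Lg (LPsi _ _).
(* Once N >= |k| + G the partial sum contains every index with a nonzero [lambda], so the error is
   exactly the pairing of the remainder with Psi_k. *)
have DE N : (`|k| + G <= N)%N ->
    coef (gamma + G%:R) f k - S
    = inner (weight (gamma + G%:R)) (r N) (Psi (gamma + G%:R) k).
  move=> kN; rewrite rE (inner_sub_sum _ _ _ _ _ _ _ (If f hfG) (fun l => If _ (LPsi gamma l))).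
  suff -> : S = \sum_(l <- fset_set [set l : int | (`|l| <= N)%N])
      coef gamma f l * lambda gamma G k l by [].
  rewrite -(fsbig_finite _ _ (finite_absz_le N)).
  under [RHS]eq_fsbigr do rewrite mulrC.
  rewrite /S; apply: fsbig_widen.
  - by move=> l /= /andP[_ h]; exact: leq_trans h kN.
  - by move=> l /= [_ /negP h]; rewrite lambda_eq0 ?mul0r.
pose K : R := \int[lebesgue_measure]_(t in `[- pi, pi])
   (ComplexField.Normc.normc (Psi (gamma + G%:R) k t) ^+ 2 * weight (gamma + G%:R) t).
have K0 : 0 <= K by apply: Rintegral_ge0 => t _; rewrite mulr_ge0 ?sqr_ge0.
have small (e : R) : 0 < e ->
    `|complex.Re (coef (gamma + G%:R) f k - S)| <= e * (1 + K) / 2 /\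
    `|complex.Im (coef (gamma + G%:R) f k - S)| <= e * (1 + K) / 2.
  move=> e0.
  (* Passing to the second weight costs 2^G, so the remainder has squared norm below e^2 there;
     Young's inequality with the same e then gives e (1 + K)/2. *)
  have eta0 : (0 < (e ^+ 2 / 2 ^+ G)%:E)%E by rewrite lte_fin divr_gt0 ?exprn_gt0.
  have /hexp near_small : nbhs (0%E : \bar R) [set y | (y < (e ^+ 2 / 2 ^+ G)%:E)%E].
    by apply: open_nbhs_nbhs; split => //; exact: open_ereal_lt_ereal.
  have {}near_small : \forall N \near \oo,
    (sqnorm (weight gamma) (r N) < (e ^+ 2 / 2 ^+ G)%:E)%E by exact: near_small.
  have [N [/= sN kN]] := filter_ex (filterI near_small (nbhs_infty_ge (`|k| + G)%N)).
  have sN' : (sqnorm (weight (gamma + G%:R)) (r N) < (e ^+ 2)%:E)%E.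
    apply: (le_lt_trans (sqnorm_le gamma G _ d0 (mr N))).
    rewrite [e ^+ 2](_ : _ = 2 ^+ G * (e ^+ 2 / 2 ^+ G)); last by field; rewrite expf_neq0.
    by rewrite EFinM lte_pmul2l// lte_fin exprn_gt0.
  have Lr : in_L2 (weight (gamma + G%:R)) (r N).
    by have [m1 m2] := mr N; split => //; apply: lt_trans sN' _; exact: ltry.
  rewrite (DE N)//.
  have [_ B1 B2] := inner_bound _ _ _ e e0 mw w0 Lr (LPsi (gamma + G%:R) k).
  have J : \int[lebesgue_measure]_(t in `[- pi, pi])
      (ComplexField.Normc.normc (r N t) ^+ 2 * weight (gamma + G%:R) t) <= e ^+ 2.
    have i := integrable_sqnorm _ _ mw w0 Lr.
    rewrite -lee_fin /Rintegral fineK ?integrable_fin_num//; exact: ltW.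
  have B : e^-1 / 2 * e ^+ 2 + e / 2 * K = e * (1 + K) / 2.
    by field; rewrite gt_eqF.
  by split; [apply: (le_trans B1)|apply: (le_trans B2)]; rewrite -B lerD2r
    ler_wpM2l// divr_ge0// invr_ge0 ltW.
(* The choice e = |x| / (1 + K) would give |x| <= |x| / 2. *)
have zero (x : R) : (forall e, 0 < e -> `|x| <= e * (1 + K) / 2) -> x = 0.
  move=> h; apply/eqP; rewrite -normr_le0 leNgt; apply/negP => x0.
  have K1 : 0 < 1 + K by lra.
  have := h (`|x| / (1 + K)) (divr_gt0 x0 K1); rewrite divfK ?gt_eqF//; lra.
apply/eqP; rewrite -subr_eq0 eq_complex /=; apply/andP; split; apply/eqP.
  by apply: zero => e /small [].
by apply: zero => e /small [].
Qed.
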